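(* Let $1\le k<d$ be integers and let $A\subset\mathbb{R}^d$ be a bounded set such that $\overline{\dim}_B(A)<t<(d-k)/2$, and let $(k-1)(d-k)+2t<w<k(d-k)$. Then the set of planes $V\in G(d,k)$ for which $A$ is not contained in the graph of a H\''older function $f_V\colon V^\perp\to V$ of exponent $1-\frac{2t}{w-(k-1)(d-k)}$ has Hausdorff dimension at most $w$. In particular, for a bounded set $A\subset\mathbb{R}^d$ with $\overline{\dim}_B(A)<(d-k)/2$, the set of $V\in G(d,k)$ such that $A$ is not contained in the graph of a H\''older function $f_V\colon V^\perp\to V$ (of any exponent) has Hausdorff dimension at most $(k-1)(d-k)+2\,\overline{\dim}_B(A)$.
   Context: $\overline{\dim}_B$ denotes upper box counting (Minkowski) dimension. $G(d,k)$ is the Grassmannian of $k$-dimensional linear subspaces of $\mathbb{R}^d$, with the metric $\varrho(V,W)=\|P_V-P_W\|$ (operator norm), where $P_V$ is the orthogonal projection of $\mathbb{R}^d$ onto $V^\perp$; Hausdorff dimension in $G(d,k)$ is taken with respect to $\varrho$. A function $f$ is H\''older of exponent $\alpha\in(0,1]$ if there is $C$ with $|f(y)-f(y')|\le C|y-y'|^\alpha$ for all $y,y'$ in its domain. The graph of $f\colon V^\perp\to V$ is the set $\{y+f(y): y\in V^\perp\}\subset\mathbb{R}^d$. *)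

(* Defs.v *)
From HB Require Import structures.
From mathcomp Require Import all_boot all_order all_algebra.
From mathcomp Require Import all_classical all_reals all_analysis.
From mathcomp Require Import ring.

Set Implicit Arguments.
Unset Strict Implicit.
Unset Printing Implicit Defensive.

Import Order.TTheory GRing.Theory Num.Theory.
Import numFieldNormedType.Exports.

Local Open Scope classical_set_scope.
Local Open Scope ring_scope.

(* Points of R^d are row vectors.  The library norm of 'rV[R]_d is the sup
   norm, so the Euclidean structure is set up separately. *)
Section Euclidean.
Context {R : realType} {d : nat}.
Implicit Types (x y z : 'rV[R]_d) (V : {vspace 'rV[R]_d}).

Definition dotv x y : R := \sum_(i < d) x 0 i * y 0 i.

Lemma dotvC x y : dotv x y = dotv y x.
Proof. by apply: eq_bigr => i _; rewrite mulrC. Qed.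

Lemma dotvDZl a x y z : dotv (a *: x + y) z = a * dotv x z + dotv y z.
Proof.
rewrite /dotv mulr_sumr -big_split /=; apply: eq_bigr => i _.
by rewrite !mxE mulrDl mulrA.
Qed.

Lemma dotv_is_bilinear : bilinear_for
  (GRing.Scale.Law.clone _ _ ( *%R ) _)
  (GRing.Scale.Law.clone _ _ (@idfun R \; *%R ) _) dotv.
Proof.
split=> [z|z] a x y /=; first exact: dotvDZl.
by rewrite dotvC dotvDZl (dotvC x) (dotvC y).
Qed.

HB.instance Definition _ :=
  bilinear_isBilinear.Build R _ _ _
    (GRing.Scale.Law.clone _ _ ( *%R ) _)
    (GRing.Scale.Law.clone _ _ (@idfun R \; *%R ) _) dotv dotv_is_bilinear.

Lemma dotv_hermitian x y : dotv x y = (-1) ^+ false * idfun (dotv y x).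
Proof. by rewrite expr0 mul1r dotvC. Qed.

HB.instance Definition _ :=
  isHermitianSesquilinear.Build R _ false idfun dotv dotv_hermitian.

Definition enorm x : R := Num.sqrt (dotv x x).

Definition ebounded (A : set 'rV[R]_d) : Prop :=
  exists M : R, forall x, A x -> enorm x <= M.

Definition orthoc V : {vspace 'rV[R]_d} := orthov dotv V.

(* Orthogonal projection onto the orthogonal complement of V, not onto V. *)
Definition perp_proj V : 'End('rV[R]_d) := daddv_pi (orthoc V) V.

Definition opnorm (f : 'rV[R]_d -> 'rV[R]_d) : R :=
  sup [set enorm (f x) | x in [set x | enorm x <= 1]].

Lemma dotv_ge0 x : 0 <= dotv x x.
Proof. by apply: sumr_ge0 => i _; rewrite -expr2 sqr_ge0. Qed.

Lemma dotv_eq0 x : (dotv x x == 0) = (x == 0).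
Proof.
apply/eqP/eqP=> [/eqP|->]; last first.
  by rewrite /dotv big1 // => i _; rewrite !mxE mul0r.
rewrite psumr_eq0 => [/allP x0|i _]; last by rewrite -expr2 sqr_ge0.
apply/rowP => i; rewrite mxE; apply/eqP; rewrite -sqrf_eq0 expr2.
by apply: x0; rewrite mem_index_enum.
Qed.

Lemma dotvDl x y z : dotv (x + y) z = dotv x z + dotv y z.
Proof. by rewrite -[x]scale1r dotvDZl mul1r scale1r. Qed.

Lemma dotvZl a x z : dotv (a *: x) z = a * dotv x z.
Proof.
rewrite -[_ *: _]addr0 dotvDZl /dotv [X in _ + X]big1 ?addr0 // => i _.
by rewrite mxE mul0r.
Qed.

Lemma dotvDr x y z : dotv z (x + y) = dotv z x + dotv z y.
Proof. by rewrite dotvC dotvDl !(dotvC z). Qed.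

Lemma dotvZr a x z : dotv z (a *: x) = a * dotv z x.
Proof. by rewrite dotvC dotvZl (dotvC z). Qed.

Lemma enorm_ge0 x : 0 <= enorm x. Proof. exact: sqrtr_ge0. Qed.

Lemma enorm_sqr x : enorm x ^+ 2 = dotv x x.
Proof. by rewrite sqr_sqrtr // dotv_ge0. Qed.

Lemma enorm_eq0 x : (enorm x == 0) = (x == 0).
Proof. by rewrite -sqrf_eq0 enorm_sqr dotv_eq0. Qed.

Lemma enorm0 : enorm 0 = 0. Proof. by apply/eqP; rewrite enorm_eq0. Qed.

Lemma enormZ a x : enorm (a *: x) = `|a| * enorm x.
Proof. by rewrite /enorm dotvZl dotvZr mulrA -expr2 sqrtrM ?sqr_ge0 // sqrtr_sqr. Qed.

Lemma enormN x : enorm (- x) = enorm x.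
Proof. by rewrite -scaleN1r enormZ normrN1 mul1r. Qed.

Lemma dotv_le x y : dotv x y <= enorm x * enorm y.
Proof.
have [->|x0] := eqVneq x 0.
  by rewrite enorm0 mul0r /dotv big1 // => i _; rewrite mxE mul0r.
have [->|y0] := eqVneq y 0.
  by rewrite enorm0 mulr0 /dotv big1 // => i _; rewrite mxE mulr0.
have xp : 0 < enorm x by rewrite lt_def enorm_eq0 x0 enorm_ge0.
have yp : 0 < enorm y by rewrite lt_def enorm_eq0 y0 enorm_ge0.
have := dotv_ge0 (enorm y *: x + (- enorm x) *: y).
rewrite !(dotvDl, dotvDr, dotvZl, dotvZr) -!enorm_sqr (dotvC y x) => h.
rewrite -subr_ge0 -(pmulr_rge0 _ (mulr_gt0 xp yp)) -(pmulr_rge0 _ (ltr0n _ 2)).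
apply: le_trans h _; rewrite le_eqVlt; apply/orP; left; apply/eqP.
rewrite !expr2; ring.
Qed.

Lemma enormD x y : enorm (x + y) <= enorm x + enorm y.
Proof.
rewrite -(@ler_pXn2r _ 2) ?nnegrE ?addr_ge0 ?enorm_ge0 //.
rewrite enorm_sqr !(dotvDl, dotvDr) (dotvC y x) -!enorm_sqr sqrrD.
by rewrite addrA lerD2r -addrA lerD2l -mulr2n lerMn2r dotv_le.
Qed.

Lemma enorm_sum (I : Type) (r : seq I) (F : I -> 'rV[R]_d) :
  enorm (\sum_(i <- r) F i) <= \sum_(i <- r) enorm (F i).
Proof.
elim/big_ind2: _ => [|x1 y1 x2 y2 h1 h2|//]; first by rewrite enorm0.
by rewrite (le_trans (enormD _ _)) // lerD.
Qed.

Lemma coord_le_enorm x i : `|x 0 i| <= enorm x.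
Proof.
rewrite -sqrtr_sqr ler_wsqrtr // /dotv (bigD1 i) //= expr2 lerDl.
by apply: sumr_ge0 => j _; rewrite -expr2 sqr_ge0.
Qed.

Lemma opnorm_has_sup (f : 'End('rV[R]_d)) :
  has_sup [set enorm (f x) | x in [set x | enorm x <= 1]].
Proof.
split; first by exists (enorm (f 0)), 0 => //=; rewrite enorm0.
exists (\sum_(i < d) enorm (f (delta_mx 0 i))) => _ [x /= x1 <-].
rewrite [x in f x]row_sum_delta linear_sum (le_trans (enorm_sum _ _)) //.
apply: ler_sum => i _; rewrite linearZ enormZ ler_piMl ?enorm_ge0 //.
exact: le_trans (coord_le_enorm _ _) x1.
Qed.

Lemma opnorm_ub (f : 'End('rV[R]_d)) x : enorm x <= 1 -> enorm (f x) <= opnorm f.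
Proof.
by move=> x1; apply: (ub_le_sup (opnorm_has_sup f).2); exists x.
Qed.

Lemma opnorm_le (f : 'End('rV[R]_d)) M :
  (forall x, enorm x <= 1 -> enorm (f x) <= M) -> opnorm f <= M.
Proof.
move=> fM; apply: ge_sup (opnorm_has_sup f).1 _ => _ [x x1 <-].
exact: fM.
Qed.

Lemma lfunBE (f g : 'End('rV[R]_d)) x : (f - g) x = f x - g x.
Proof. by rewrite lfunE /= lfunE. Qed.

Lemma capv_orthoc V : (V :&: orthoc V = 0)%VS.
Proof.
apply/eqP; rewrite -subv0; apply/subvP => x; rewrite memv_cap memv0.
by case/andP=> xV /mem_orthovP/(_ _ xV)/eqP; rewrite dotv_eq0.
Qed.

Lemma addv_orthoc V : (V + orthoc V = fullv)%VS.
Proof.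
apply/eqP; rewrite eqEdim subvf /= dimv_disjoint_sum ?capv_orthoc //.
pose g (x : 'rV[R]_d) : 'rV[R]_(\dim V) := \row_i dotv x (vbasis V)`_i.
have g_lin : linear g.
  by move=> a x y; apply/rowP => i; rewrite !mxE dotvDZl.
pose gL := GRing.isLinear.Build _ _ _ _ g g_lin.
pose G : {linear _ -> _} := HB.pack g gL.
have gE : linfun G =1 g by move=> x; rewrite lfunE.
rewrite -(limg_ker_dim (linfun G) fullv) capfv addnC leq_add //.
  by rewrite (leq_trans (dimvS (subvf _))) // dimvf /dim /= mul1n.
apply/dimvS/subvP => x; rewrite memv_ker gE => /eqP/rowP gx.
apply/mem_orthovP => v vV; rewrite (coord_vbasis vV).
rewrite linear_sumr big1 //= => i _.
by have := gx i; rewrite !mxE dotvZr => ->; rewrite mulr0.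
Qed.

Lemma perp_proj_eq0 V x : (perp_proj V x == 0) = (x \in V).
Proof.
have xP : x \in (V + orthoc V)%VS by rewrite addv_orthoc memvf.
have := daddv_pi_add (capv_orthoc V) xP; rewrite -/(perp_proj V) => xE.
apply/eqP/idP => [P0|xV].
  by rewrite -xE P0 addr0 memv_pi.
move: xE; rewrite (daddv_pi_id (capv_orthoc V) xV) => /(canRL (addKr _)) ->.
by rewrite addNr.
Qed.

End Euclidean.

Section Grassmannian.
Context (R : realType) (d k : nat).

Definition grassmannian : Type := {V : {vspace 'rV[R]_d} | \dim V == k}.

HB.instance Definition _ := Choice.on grassmannian.

Definition plane (V : grassmannian) : {vspace 'rV[R]_d} := val V.

Definition gr_dist (V W : grassmannian) : R :=
  opnorm (perp_proj (plane V) - perp_proj (plane W)).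

Let gr_distxx V : gr_dist V V = 0.
Proof.
apply/eqP; rewrite /gr_dist subrr eq_le; apply/andP; split.
  by apply: opnorm_le => x _; rewrite lfunE /= enorm0.
have := @opnorm_ub R d 0 0; rewrite enorm0 ler01 => /(_ isT).
by rewrite lfunE /= enorm0.
Qed.

Let gr_dist_sub V W : gr_dist V W = 0 -> (plane V <= plane W)%VS.
Proof.
move=> VW0; apply/subvP => x; have [->|x0] := eqVneq x 0; first by rewrite !mem0v.
rewrite -perp_proj_eq0 => /eqP PV; rewrite -perp_proj_eq0.
have xn : enorm x != 0 by rewrite enorm_eq0.
have := opnorm_ub (perp_proj (plane V) - perp_proj (plane W))
  (x := (enorm x)^-1 *: x).
rewrite enormZ ger0_norm ?invr_ge0 ?enorm_ge0 // mulVf // lexx => /(_ isT).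
rewrite -/(gr_dist V W) VW0 linearZ /= enormZ lfunBE PV add0r enormN.
rewrite pmulr_rle0; last by rewrite normr_gt0 invr_eq0.
by rewrite le_eqVlt ltNge enorm_ge0 orbF enorm_eq0.
Qed.

Let gr_dist_sym V W : gr_dist V W = gr_dist W V.
Proof.
have le V' W' : gr_dist V' W' <= gr_dist W' V'.
  apply: opnorm_le => x x1; rewrite lfunBE -enormN opprB -lfunBE.
  exact: opnorm_ub.
by apply/le_anti/andP; split; exact: le.
Qed.

Let gr_dist_positivity V W : gr_dist V W = 0 -> V = W.
Proof.
move=> VW0; apply/val_inj/eqP; rewrite eqEsubv.
apply/andP; split; first exact: gr_dist_sub VW0.
exact: gr_dist_sub (etrans (gr_dist_sym W V) VW0).
Qed.

Let gr_dist_triangle W V U : gr_dist V U <= gr_dist V W + gr_dist W U.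
Proof.
apply: opnorm_le => x x1.
rewrite lfunBE -(subrKA (perp_proj (plane W) x)) -!lfunBE.
by rewrite (le_trans (enormD _ _)) // lerD // opnorm_ub.
Qed.

HB.instance Definition _ := isMetric.Build R grassmannian
  gr_distxx gr_dist_positivity gr_dist_sym gr_dist_triangle.

End Grassmannian.

Section HausdorffDimension.
Context {R : realType} {T : metricType R}.
Local Open Scope ereal_scope.

Definition diam (U : set T) : \bar R :=
  ereal_sup [set (mdist p.1 p.2)%:E | p in U `*` U].

(* The empty set has no diameter (the supremum above is -oo) and costs 0,
   also for s = 0. *)
Definition diam_pow (s : R) (U : set T) : \bar R :=
  if U == set0 then 0 else diam U `^ s.

Definition hausdorff_premeasure (s delta : R) (A : set T) : \bar R :=
  ereal_inf [set \sum_(0 <= n <oo) diam_pow s (U n) | U in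
    [set U : nat -> set T | A `<=` \bigcup_n U n /\
      forall n, diam (U n) <= delta%:E]].

Definition hausdorff_measure (s : R) (A : set T) : \bar R :=
  ereal_sup [set hausdorff_premeasure s delta A | delta in [set x | (0 < x)%R]].

Definition hausdorff_dim (A : set T) : \bar R :=
  ereal_inf [set s%:E | s in [set s | (0 <= s)%R /\ hausdorff_measure s A = 0]].

End HausdorffDimension.

Section BoxDimension.
Context {R : realType} {d : nat}.
Local Open Scope ereal_scope.

(* Covers are required to have at least one ball, so that the logarithm below
   is nonnegative and the empty set gets box dimension 0. *)
Definition covering_number (A : set 'rV[R]_d) (e : R) : \bar R :=
  ereal_inf [set n%:R%:E | n in [set n | (0 < n)%N /\
    exists c : 'I_n -> 'rV[R]_d,
      forall x, A x -> exists i, (enorm (x - c i)%R <= e)%R]].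

Definition upper_box_dim (A : set 'rV[R]_d) : \bar R :=
  limf_esup (fun e => lne (covering_number A e) * ((- ln e)^-1)%:E) 0%R^'+.

End BoxDimension.

Section Graphs.
Context {R : realType} {d : nat}.
Implicit Types (V W : {vspace 'rV[R]_d}) (A : set 'rV[R]_d).

Definition hoelder V W (a : R) (f : subvs_of V -> subvs_of W) : Prop :=
  [/\ 0 < a, a <= 1 &
    exists C : R, forall y y',
      enorm (vsval (f y) - vsval (f y')) <= C * enorm (vsval y - vsval y') `^ a].

Definition graph V (f : subvs_of (orthoc V) -> subvs_of V) : set 'rV[R]_d :=
  [set vsval y + vsval (f y) | y in [set: subvs_of (orthoc V)]].

Definition in_hoelder_graph A (a : R) V : Prop :=
  exists f : subvs_of (orthoc V) -> subvs_of V, hoelder a f /\ A `<=` graph f.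

End Graphs.

(* Main.v *)
Require Import Defs.
From HB Require Import structures.
From mathcomp Require Import all_boot all_order all_algebra.
From mathcomp Require Import all_classical all_reals all_analysis.
From mathcomp Require Import ring lra.

Set Implicit Arguments.
Unset Strict Implicit.
Unset Printing Implicit Defensive.

Import Order.TTheory GRing.Theory Num.Theory.
Import numFieldNormedType.Exports.

Local Open Scope classical_set_scope.
Local Open Scope ring_scope.

(* If P_V is bounded below on differences, |P_V (x - y)| >= c |x - y|^(1/th) on A,
   then P_V is injective on A with th-Hoelder inverse, and McShane's extension,
   applied coordinatewise and projected to V, gives the function f_V.  A plane V
   that is exceptional thus has, for every c, a pair of points of A at some
   dyadic scale r with |P_V (x - y)| < e := c r^(1/th).  Replacing x and y by
   centers of an e-cover of A (about e^-t of them), V is within O(e/r) of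
   containing one of e^-2t given unit directions u.  In the charts V = rowspace N,
   with N equal to the identity on k columns and all entries bounded by 1, the
   planes within delta of containing u are covered by O(delta^-((k-1)(d-k))) sets
   of diameter O(delta).  The resulting covers have w-dimensional sum bounded by
   a positive power of c times a geometric series over the scales. *)

(** * Orthogonal projections and the operator norm of their differences *)

Section Projections.
Context {R : realType} {d : nat}.
Implicit Types (x y z : 'rV[R]_d) (V : {vspace 'rV[R]_d}).

Lemma sum_ord_le n (F : 'I_n -> R) (c : R) :
  (forall i, F i <= c) -> \sum_(i < n) F i <= n%:R * c.
Proof.
move=> Fc; rewrite mulr_natl -[n in leRHS]card_ord -sumr_const.
exact: ler_sum.
Qed.

Lemma enorm_le_sum_coord x : enorm x <= \sum_(j < d) `|x 0 j|.
Proof.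
rewrite [x in enorm x]row_sum_delta; apply: (le_trans (enorm_sum _ _)).
apply: ler_sum => j _; rewrite enormZ ler_piMr //.
rewrite /enorm /dotv (bigD1 j) //= big1 => [|i ij].
  by rewrite !mxE !eqxx mulr1 addr0 sqrtr1.
by rewrite !mxE (negbTE ij) andbF mulr0.
Qed.

Lemma perp_proj_in V x : perp_proj V x \in orthoc V.
Proof. exact: memv_pi. Qed.

Lemma sub_perp_proj_in V x : x - perp_proj V x \in V.
Proof.
have xP : x \in (V + orthoc V)%VS by rewrite addv_orthoc memvf.
have := daddv_pi_add (capv_orthoc V) xP; rewrite -/(perp_proj V) => xE.
by rewrite -{1}xE addrK memv_pi.
Qed.

Lemma dotv_orthoc V x y : x \in V -> y \in orthoc V -> dotv x y = 0.
Proof. by move=> xV /mem_orthovP/(_ _ xV); rewrite dotvC. Qed.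

Lemma perp_proj0 V x : x \in V -> perp_proj V x = 0.
Proof. by rewrite -perp_proj_eq0 => /eqP. Qed.

Lemma perp_proj_sub V x y : perp_proj V (x - y) = perp_proj V x - perp_proj V y.
Proof. exact: linearB. Qed.

Lemma pythagoras V x :
  dotv x x = dotv (perp_proj V x) (perp_proj V x)
             + dotv (x - perp_proj V x) (x - perp_proj V x).
Proof.
have := dotv_orthoc (sub_perp_proj_in V x) (perp_proj_in V x).
move: (perp_proj V x) => p o; rewrite -{1 2}(subrK p x); move: (x - p) o => q o.
by rewrite dotvDl !dotvDr (dotvC p q) o addr0 add0r addrC.
Qed.

Lemma enorm_perp_proj V x : enorm (perp_proj V x) <= enorm x.
Proof. by rewrite ler_wsqrtr // [leRHS](pythagoras V) lerDl dotv_ge0. Qed.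

Lemma enorm_sub_perp_proj V x : enorm (x - perp_proj V x) <= enorm x.
Proof. by rewrite ler_wsqrtr // [leRHS](pythagoras V) lerDr dotv_ge0. Qed.

(* [P_V - P_W = P_V Q_W - Q_V P_W] with [Q = 1 - P], and [Q_V P_W] is the
   adjoint of [P_W Q_V]. *)
Lemma opnorm_perp_proj_sub V (W : {vspace 'rV[R]_d}) (c : R) :
  (forall x, x \in W -> enorm (perp_proj V x) <= c * enorm x) ->
  (forall x, x \in V -> enorm (perp_proj W x) <= c * enorm x) -> 0 <= c ->
  opnorm (perp_proj V - perp_proj W) <= 2 * c.
Proof.
move=> VW WV c0; apply: opnorm_le => x x1.
rewrite lfunBE; set q := x - perp_proj W x; set p := perp_proj W x.
have -> : perp_proj V x - p = perp_proj V q - (p - perp_proj V p).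
  by rewrite /q perp_proj_sub -/p opprB addrA subrK.
rewrite (le_trans (enormD _ _)) // enormN mulrDl mul1r lerD //.
  apply: le_trans (VW _ (sub_perp_proj_in _ _)) _.
  by rewrite ler_piMr // (le_trans (enorm_sub_perp_proj _ _)).
set z := p - perp_proj V p.
have zV : z \in V by exact: sub_perp_proj_in.
have z2 : enorm z ^+ 2 <= c * enorm z.
  (* The adjoint relation in terms of inner products: [z], in [V], is orthogonal to [perp_proj V p],
     and [z - perp_proj W z], in [W], is orthogonal to [p]. Hence [|z|^2 = <z, p> = <P_W z, p>], at
     most [c |z|]. *)
  have zz : dotv z z = dotv (perp_proj W z) (perp_proj W x).
    have zp : dotv z p = dotv z z.
      have := dotvDr z (perp_proj V p) z.
      by rewrite [z + _]subrK (dotv_orthoc zV (perp_proj_in V p)) addr0.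
    have := dotvDl (z - perp_proj W z) (perp_proj W z) p.
    rewrite subrK (dotv_orthoc (sub_perp_proj_in W z) (perp_proj_in W x)) add0r.
    by rewrite zp.
  rewrite enorm_sqr zz (le_trans (dotv_le _ _)) // -[leRHS]mulr1.
  rewrite ler_pM ?enorm_ge0 ?WV //.
  exact: le_trans (enorm_perp_proj _ _) x1.
have [-> //|z0] := eqVneq z 0; first by rewrite enorm0.
by move: z2; rewrite expr2 ler_pM2r // lt_def enorm_eq0 z0 enorm_ge0.
Qed.

End Projections.

(** * Hoelder extension and the graph criterion *)

Section HoelderExtension.
Context {R : realType}.

(** A ratio [c / (a + b)] in [0, 1] does not decrease when raised to the power [th <= 1]; adding the
    cases [c = a] and [c = b] gives the inequality. *)
Lemma powR_subadditive (a b th : R) : 0 <= a -> 0 <= b -> 0 < th -> th <= 1 ->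
  (a + b) `^ th <= a `^ th + b `^ th.
Proof.
move=> a0 b0 th0 th1.
have [->|an] := eqVneq a 0; first by rewrite powR0 ?gt_eqF // !add0r.
have ap : 0 < a by rewrite lt_def an.
have sp : 0 < a + b by rewrite ltr_wpDr.
have key c : 0 <= c -> c <= a + b -> c / (a + b) * (a + b) `^ th <= c `^ th.
  move=> c0 cab.
  have [->|cn] := eqVneq c 0; first by rewrite !mul0r powR_ge0.
  have cp : 0 < c by rewrite lt_def cn.
  have -> : c `^ th = (c / (a + b)) `^ th * (a + b) `^ th.
    by rewrite -powRM ?divr_ge0 ?(ltW sp) // divfK // gt_eqF.
  rewrite ler_wpM2r ?powR_ge0 // ger1_powR // divr_gt0 //=.
  by rewrite ler_pdivrMr // mul1r.
have -> : (a + b) `^ th = a / (a + b) * (a + b) `^ th + b / (a + b) * (a + b) `^ th.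
  by rewrite -mulrDl -mulrDl divff ?mul1r // gt_eqF.
by rewrite lerD // key // (lerDl, lerDr).
Qed.

Context {d : nat}.
Implicit Types (x y z : 'rV[R]_d) (V : {vspace 'rV[R]_d}).

Lemma enorm_powR_triangle x y z (th : R) : 0 < th -> th <= 1 ->
  enorm (x - z) `^ th <= enorm (x - y) `^ th + enorm (y - z) `^ th.
Proof.
move=> th0 th1; apply: le_trans (powR_subadditive _ _ th0 th1); rewrite ?enorm_ge0 //.
rewrite ge0_ler_powR ?nnegrE ?addr_ge0 ?enorm_ge0 ?(ltW th0) //.
by rewrite -[X in enorm X](subrKA y) enormD.
Qed.

Lemma enorm_distC x y : enorm (x - y) = enorm (y - x).
Proof. by rewrite -enormN opprB. Qed.

(* McShane's extension [y |-> inf_i (g i + C |y - p i|^th)]. *)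
Lemma mcshane (I : Type) (p : I -> 'rV[R]_d) (g : I -> R) (C th : R) (i0 : I) :
  0 <= C -> 0 < th -> th <= 1 ->
  (forall i j, g i - g j <= C * enorm (p i - p j) `^ th) ->
  exists F : 'rV[R]_d -> R, (forall i, F (p i) = g i) /\
    forall y z, `|F y - F z| <= C * enorm (y - z) `^ th.
Proof.
move=> C0 th0 th1 gp.
pose S y : set R := range (fun i => g i + C * enorm (y - p i) `^ th).
have Slb y : lbound (S y) (g i0 - C * enorm (y - p i0) `^ th).
  move=> _ [i _ <-]; rewrite lerBlDr -addrA -mulrDr -lerBlDl.
  apply: le_trans (gp i0 i) _; rewrite ler_wpM2l // [leRHS]addrC.
  by rewrite [enorm (y - p i0)]enorm_distC enorm_powR_triangle.
have Sinf y : has_inf (S y).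
  split; first by exists (g i0 + C * enorm (y - p i0) `^ th), i0.
  by exists (g i0 - C * enorm (y - p i0) `^ th).
have Fle y z : inf (S y) - inf (S z) <= C * enorm (y - z) `^ th.
  rewrite lerBlDr addrC -lerBlDr; apply: lb_le_inf; first exact: (Sinf z).1.
  move=> _ [i _ <-]; rewrite lerBlDr.
  apply: (@le_trans _ _ (g i + C * enorm (y - p i) `^ th)).
    by apply: (ge_inf (Sinf y).2); exists i.
  by rewrite -addrA lerD2l -mulrDr ler_wpM2l // [leRHS]addrC enorm_powR_triangle.
exists (fun y => inf (S y)); split=> [i|y z]; last first.
  by rewrite ler_norml Fle lerNl opprB enorm_distC Fle.
apply/le_anti/andP; split.
  apply: (ge_inf (Sinf (p i)).2); exists i => //.
  by rewrite subrr enorm0 powR0 ?gt_eqF // mulr0 addr0.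
apply: lb_le_inf; first exact: (Sinf (p i)).1.
by move=> _ [j _ <-]; rewrite -lerBlDl gp.
Qed.

(** The hypothesis makes [P_V x |-> x - P_V x] well defined and Hoelder on the projection of [A].
    Its coordinates extend separately, at the cost of a factor [d]; the extension may leave [V], and
    projecting it to [V] increases no distance and fixes the prescribed values. *)
Lemma in_hoelder_graph_of_lower_bound (A : set 'rV[R]_d) V (C th : R) :
  0 <= C -> 0 < th -> th <= 1 ->
  (forall x y, A x -> A y ->
     enorm (x - y) <= C * enorm (perp_proj V (x - y)) `^ th) ->
  in_hoelder_graph A th V.
Proof.
move=> C0 th0 th1 AC.
(* McShane's infimum needs a point of [A]; for empty [A] the zero function serves. *)
have [->|/set0P[x0 Ax0]] := eqVneq A set0.
  exists (fun=> 0); split; last by [].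
  split=> //; exists 0 => y y'.
  by rewrite subrr enorm0 mul0r.
pose p (i : {x | A x}) := perp_proj V (sval i).
pose h (i : {x | A x}) := sval i - p i.
have hp i j : enorm (h i - h j) <= C * enorm (p i - p j) `^ th.
  have -> : h i - h j = (sval i - sval j) - perp_proj V (sval i - sval j).
    by rewrite perp_proj_sub /h !opprB addrACA [RHS]addrACA; congr (_ + _); rewrite addrC.
  apply: le_trans (enorm_sub_perp_proj _ _) _.
  rewrite /p -perp_proj_sub; apply: AC; exact: (svalP _).
have ext (j : 'I_d) : exists F : 'rV[R]_d -> R, (forall i, F (p i) = h i 0 j) /\
    forall y z, `|F y - F z| <= C * enorm (y - z) `^ th.
  apply: (mcshane (exist _ x0 Ax0)) => // a b; apply: le_trans (hp a b).
  have := coord_le_enorm (h a - h b) j; rewrite !mxE; apply: le_trans.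
  exact: ler_norm.
have [F FP] := choice ext.
pose G y : 'rV[R]_d := \row_j F j y.
have GV y : G y - perp_proj V (G y) \in V by exact: sub_perp_proj_in.
exists (fun y : subvs_of (orthoc V) => Subvs (GV (vsval y))); split.
  split=> //; exists (d%:R * C) => y y' /=.
  have -> : G (vsval y) - perp_proj V (G (vsval y)) -
    (G (vsval y') - perp_proj V (G (vsval y'))) =
    (G (vsval y) - G (vsval y')) - perp_proj V (G (vsval y) - G (vsval y')).
    by rewrite perp_proj_sub !opprB addrACA [RHS]addrACA; congr (_ + _); rewrite addrC.
  apply: le_trans (enorm_sub_perp_proj _ _) _.
  apply: le_trans (enorm_le_sum_coord _) _.
  rewrite -mulrA sum_ord_le // => j.
  by rewrite !mxE (FP j).2.
move=> x Ax; pose i : {x | A x} := exist _ x Ax.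
exists (Subvs (perp_proj_in V x)) => //=.
have -> : G (perp_proj V x) = h i.
  apply/rowP => j; rewrite !mxE; have := (FP j).1 i.
  by rewrite /p /= => ->; rewrite !mxE.
by rewrite (perp_proj0 (sub_perp_proj_in _ _)) subr0 /h /p /= addrC subrK.
Qed.

End HoelderExtension.

(** * Charts of the Grassmannian by normalized matrices *)

Section Charts.
Context {R : realType} {d k : nat}.
Implicit Types (V W : grassmannian R d k) (f : {ffun 'I_k -> 'I_d}).

(** The rows of [N] are a basis of [V] in reduced form, with pivot columns [f]. The bound on the
    entries confines the charts to a compact cube. *)
Definition is_chart V f (N : 'M[R]_(k, d)) : Prop :=
  [/\ colsub f N = 1%:M, (forall i j, `|N i j| <= 1) &
      forall x : 'rV[R]_d, (x \in plane V) <-> exists y : 'rV[R]_k, x = y *m N].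

Lemma plane_basis V : exists M : 'M[R]_(k, d), row_free M /\
  forall x : 'rV[R]_d, (x \in plane V) <-> exists y : 'rV[R]_k, x = y *m M.
Proof.
have dimV : \dim (plane V) = k by apply/eqP; exact: (valP V).
pose M : 'M[R]_(k, d) := \matrix_(i < k, j < d) (vbasis (plane V))`_i 0 j.
have rowM i : row i M = (vbasis (plane V))`_i by apply/rowP => j; rewrite !mxE.
have mulM (y : 'rV[R]_k) : y *m M = \sum_i y 0 i *: (vbasis (plane V))`_i.
  by rewrite mulmx_sum_row; apply: eq_bigr => i _; rewrite rowM.
have bV : basis_of (plane V) (vbasis (plane V)) by exact: vbasisP.
exists M; split.
  apply: inj_row_free => y; rewrite mulM => y0; apply/rowP => i.
  have /freeP/(_ (fun j => y 0 (cast_ord dimV j))) := basis_free bV.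
  rewrite mxE -[i](cast_ordKV dimV); apply.
  rewrite -[RHS]y0 [RHS](reindex (cast_ord dimV)) //=.
  by exists (cast_ord (esym dimV)) => j _; apply/val_inj.
move=> x; split=> [xV|[y ->]]; last first.
  rewrite mulM; apply: memv_suml => i _; apply: memvZ.
  by apply: vbasis_mem; rewrite mem_nth // size_tuple dimV.
exists (\row_i coord (vbasis (plane V)) (cast_ord (esym dimV) i) x).
rewrite mulM {1}(coord_vbasis xV) (reindex (cast_ord (esym dimV))) /=; last first.
  by exists (cast_ord dimV) => i _; apply/val_inj.
by apply: eq_bigr => i _; rewrite mxE.
Qed.

(** Cramer's rule for the identity matrix: the cofactors along column [i] do not see that column, so
    they are those of the identity. *)
Lemma det_replace_col (i : 'I_k) (v : 'cV[R]_k) :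
  \det (\matrix_(a, b) (if b == i then v a 0 else (a == b)%:R)) = v i 0.
Proof.
set A := matrix_of_fun _ _.
rewrite (expand_det_col _ i).
have cof a : cofactor A a i = cofactor (1%:M : 'M[R]_k) a i.
  rewrite /cofactor; congr (_ * \det _); apply/matrixP => p q.
  by rewrite !mxE eq_sym (negbTE (neq_lift _ _)).
under eq_bigr => a _ do rewrite cof.
transitivity (\sum_a v a 0 * (\adj (1%:M : 'M[R]_k)) i a).
  by apply: eq_bigr => a _; rewrite !mxE eqxx.
have -> : \adj (1%:M : 'M[R]_k) = 1%:M.
  by have := mul_mx_adj (1%:M : 'M[R]_k); rewrite mul1mx det1.
rewrite (bigD1 i) //= big1 => [|a ai]; first by rewrite mxE eqxx mulr1 addr0.
by rewrite mxE eq_sym (negbTE ai) mulr0.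
Qed.

(* Normalize a basis of [V] at a maximal minor: the entries then are quotients
   of minors by the maximal one. *)
Lemma exists_chart V : exists f N, is_chart V f N.
Proof.
have [M [Mfree MV]] := plane_basis V.
pose D (f : {ffun 'I_k -> 'I_d}) : R := `|\det (colsub f M)|.
(* A matrix of full rank has a nonzero maximal minor, so the largest one can be divided by. *)
have [f0 f0P] : exists f0 : {ffun 'I_k -> 'I_d}, D f0 != 0.
  have Tfull : row_full M^T by rewrite /row_full mxrank_tr.
  exists (fullrankfun Tfull).
  have := fullrowsub_unit Tfull.
  by rewrite -[rowsub _ _]trmxK trmx_mxsub trmxK unitmx_tr unitmxE unitfE normr_eq0.
pose f := [arg max_(f > f0) D f]%O.
have fmax g : D g <= D f.
  by rewrite /f; case: arg_maxP => // h _ /(_ g isT).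
have Df : 0 < D f.
  by apply: lt_le_trans (fmax f0); rewrite lt_def f0P normr_ge0.
have Mfu : colsub f M \in unitmx by rewrite unitmxE unitfE -normr_gt0.
pose N := invmx (colsub f M) *m M.
have colN (g : 'I_k -> 'I_d) : colsub g N = invmx (colsub f M) *m colsub g M.
  by rewrite /N -mulmx_colsub.
exists f, N; split.
- by rewrite colN mulVmx.
(* As [N] is the identity on [f], exchanging the [i]-th pivot column for column [j] gives a minor
   equal to [N i j]; for [M] this minor is bounded by the one at [f]. *)
- move=> i j; pose g := [ffun b => if b == i then j else f b].
  have N1 : colsub f N = 1%:M by rewrite colN mulVmx.
  have -> : N i j = \det (colsub g N).
    have := det_replace_col i (col j N); rewrite mxE => <-; congr (\det _).
    apply/matrixP => a b; rewrite !mxE ffunE.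
    case: eqP => // _; move/matrixP: N1 => /(_ a b).
    by rewrite !mxE.
  rewrite colN det_mulmx det_inv normrM normfV mulrC ler_pdivrMr // mul1r.
  exact: fmax.
- move=> x; rewrite MV; split=> -[y ->].
    by exists (y *m colsub f M); rewrite mulmxA mulmxK.
  by exists (y *m invmx (colsub f M)); rewrite mulmxA.
Qed.

Lemma chart_inj V f N : is_chart V f N -> injective f.
Proof.
case=> /matrixP N1 _ _ i j fij.
have := N1 i i; have := N1 i j; rewrite !mxE -fij => ->; rewrite eqxx.
by case: eqP => // _ /eqP; rewrite eq_sym oner_eq0.
Qed.

(* The coordinates of [x \in V] in the rows of [N] are its entries at [f]. *)
Lemma chartE V f N (x : 'rV[R]_d) j : is_chart V f N -> x \in plane V ->
  x 0 j = \sum_i x 0 (f i) * N i j.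
Proof.
case=> N1 _ NV /NV[y ->].
suff yE i : (y *m N) 0 (f i) = y 0 i.
  by rewrite mxE; apply: eq_bigr => i _; rewrite yE.
transitivity ((y *m colsub f N) 0 i); last by rewrite N1 mulmx1.
by rewrite !mxE; apply: eq_bigr => a _; rewrite !mxE.
Qed.

(** The point of [V] with the same chart coordinates [y] as [x] differs from [x] by [y *m (N - M)],
    which bounds the distance from [x] to [V]. *)
Lemma perp_proj_chart_le V W f (M N : 'M[R]_(k, d)) (e : R) : 0 <= e ->
  is_chart V f M -> is_chart W f N -> (forall i j, `|M i j - N i j| <= e) ->
  forall x : 'rV[R]_d, x \in plane W ->
    enorm (perp_proj (plane V) x) <= (d%:R * (k%:R * e)) * enorm x.
Proof.
move=> e0 MV NW MN x xW.
pose y : 'rV[R]_k := \row_i x 0 (f i).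
have xE : x = y *m N.
  apply/rowP => j; rewrite mxE (chartE j NW xW).
  by apply: eq_bigr => i _; rewrite mxE.
have yV : y *m M \in plane V by case: MV => _ _ ->; exists y.
have -> : perp_proj (plane V) x = perp_proj (plane V) (x - y *m M).
  by rewrite perp_proj_sub (perp_proj0 yV) subr0.
rewrite (le_trans (enorm_perp_proj _ _)) // (le_trans (enorm_le_sum_coord _)) //.
rewrite -!mulrA sum_ord_le // => j.
rewrite {1}xE !mxE -sumrB (le_trans (ler_norm_sum _ _ _)) //.
rewrite sum_ord_le // => i.
rewrite -mulrBr normrM mulrC ler_pM //; first by rewrite distrC MN.
by rewrite mxE coord_le_enorm.
Qed.

Lemma gr_dist_chart_le V W f (M N : 'M[R]_(k, d)) (e : R) : 0 <= e ->
  is_chart V f M -> is_chart W f N -> (forall i j, `|M i j - N i j| <= e) ->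
  gr_dist V W <= 2 * (d%:R * (k%:R * e)).
Proof.
move=> e0 MV NW MN; apply: opnorm_perp_proj_sub.
- exact: (perp_proj_chart_le e0 MV NW MN).
- by apply: (perp_proj_chart_le e0 NW MV) => i j; rewrite distrC.
- by rewrite !mulr_ge0.
Qed.

(** The part of [u] in [V] satisfies the chart equation exactly. The error involves [k + 1]
    coordinates of the projection, each at most [e], with weights at most 1. *)
Lemma chart_near V f N (u : 'rV[R]_d) (e : R) j : is_chart V f N ->
  enorm (perp_proj (plane V) u) <= e ->
  `|u 0 j - \sum_i u 0 (f i) * N i j| <= k.+1%:R * e.
Proof.
move=> NV ue; set p := perp_proj (plane V) u in ue *.
have := chartE j NV (sub_perp_proj_in (plane V) u); rewrite -/p.
rewrite !mxE => /eqP; rewrite subr_eq => /eqP uj.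
have -> : u 0 j - \sum_i u 0 (f i) * N i j = p 0 j - \sum_i p 0 (f i) * N i j.
  rewrite uj addrAC addrC; congr (_ + _); rewrite -sumrB -sumrN; apply: eq_bigr => i _.
  by rewrite !mxE; ring.
have pe i : `|p 0 i| <= e by apply: le_trans (coord_le_enorm _ _) ue.
rewrite (le_trans (ler_normB _ _)) // -natr1 mulrDl mul1r addrC lerD //.
rewrite (le_trans (ler_norm_sum _ _ _)) //.
rewrite sum_ord_le // => i.
by rewrite normrM -[leRHS]mulr1 ler_pM //; case: NV.
Qed.

End Charts.

(** * Finite covers by sets of bounded diameter *)

Section FiniteCovers.
Context {R : realType} {T : metricType R}.
Implicit Types E : set T.

(** Pieces may be empty, so [m] is only an upper bound for the number of sets and can be
    enlarged. *)
Definition fin_cover E (m : nat) (e : R) : Prop :=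
  exists S : 'I_m -> set T, E `<=` \bigcup_i S i /\
    forall i x y, S i x -> S i y -> mdist x y <= e.

Lemma fin_cover_sub E F m e : E `<=` F -> fin_cover F m e -> fin_cover E m e.
Proof. by move=> EF [S [FS Se]]; exists S; split => // x /EF/FS. Qed.

Lemma fin_cover_le E m n e c : (m <= n)%N -> e <= c ->
  fin_cover E m e -> fin_cover E n c.
Proof.
move=> mn ec [S [ES Se]].
exists (fun i => if insub (val i) is Some j then S j else set0); split.
  move=> x /ES[i _ Six]; exists (widen_ord mn i) => //=.
  by rewrite valK.
by move=> i x y; case: insubP => // j _ _ xS yS; apply: le_trans (Se _ _ _ xS yS) ec.
Qed.

Lemma fin_cover_union (X : finType) (F : X -> set T) m e :
  (forall i, fin_cover (F i) m e) -> fin_cover (\bigcup_i F i) (#|X| * m) e.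
Proof.
move=> /choice[S SP].
have cX : #|{: X * 'I_m}| = (#|X| * m)%N by rewrite card_prod card_ord.
rewrite -cX; exists (fun i => S (enum_val i).1 (enum_val i).2); split.
  move=> x [i _ /(SP i).1[j _ Sx]]; exists (enum_rank (i, j)) => //.
  by rewrite enum_rankK.
by move=> i x y; apply: (SP _).2.
Qed.

(** The pieces are the fibres of [h]: a discretization of the points becomes a cover. *)
Lemma fin_cover_code (X : finType) (P : {pred X}) (h : T -> X) E e :
  (forall x, E x -> h x \in P) ->
  (forall x y, E x -> E y -> h x = h y -> mdist x y <= e) ->
  fin_cover E #|P| e.
Proof.
move=> hP he; exists (fun i => [set x | E x /\ h x = enum_val i]); split.
  move=> x Ex; exists (enum_rank_in (hP x Ex) (h x)) => //=.
  by rewrite enum_rankK_in // hP.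
by move=> i x y [Ex hx] [Ey hy]; apply: he => //; rewrite hx hy.
Qed.

End FiniteCovers.

(** * Covering the planes that almost contain a given direction *)

Section NearDirection.
Context {R : realType} {d k : nat} (k1 : (1 <= k)%N) (kd : (k < d)%N).

Definition near_direction (u : 'rV[R]_d) (e : R) : set (grassmannian R d k) :=
  [set V | enorm (perp_proj (plane V) u) <= e].

(** The last condition keeps the pivot coordinate [u 0 (f i)] away from 0, so that row [i] of the
    chart can be solved for. *)
Definition chart_piece (u : 'rV[R]_d) (e : R) (f : {ffun 'I_k -> 'I_d})
    (i : 'I_k) : set (grassmannian R d k) :=
  [set V | [/\ near_direction u e V, exists N, is_chart V f N &
     1 <= (2 * d * k)%:R * `|u 0 (f i)|]].

(** If all pivot coordinates of [u] were below [1 / (2 d k)], the chart equation, with error at most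
    [1 / (2 d)], would put every coordinate below [1 / d], and [u] could not have norm 1. *)
Lemma near_direction_pieces (u : 'rV[R]_d) e : enorm u = 1 -> 0 <= e ->
  (2 * d * k.+1)%:R * e <= 1 ->
  near_direction u e `<=`
    \bigcup_(p in [set: {ffun 'I_k -> 'I_d} * 'I_k]) chart_piece u e p.1 p.2.
Proof.
move=> u1 e0 de V Vu; have [f [N VN]] := exists_chart V.
apply: contrapT => nV.
have small i : (2 * d * k)%:R * `|u 0 (f i)| < 1.
  rewrite ltNge; apply/negP => ui; apply: nV; exists (f, i) => //=.
  by split=> //; exists N.
have d0 : 0 < d%:R :> R by rewrite ltr0n (leq_trans _ kd).
have k0 : 0 < k%:R :> R by rewrite ltr0n.
have uj j : 2 * d%:R * `|u 0 j| < 2.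
  have h1 := chart_near j VN Vu.
  have h2 : `|\sum_i u 0 (f i) * N i j| <= \sum_i `|u 0 (f i)|.
    rewrite (le_trans (ler_norm_sum _ _ _)) // ler_sum // => i _.
    by rewrite normrM ler_piMr //; case: VN.
  have h3 : 2 * d%:R * (\sum_i `|u 0 (f i)|) < 1.
    rewrite mulr_sumr -(@ltr_pM2l _ k%:R) // mulr1.
    rewrite mulr_sumr -[X in _ < X%:R]card_ord -sum1_card natr_sum.
    apply: ltr_sum => [|i _].
      by apply/hasP; exists (Ordinal k1) => //; rewrite mem_index_enum.
    by have := small i; rewrite !natrM; lra.
  have h4 : `|u 0 j| <= k.+1%:R * e + \sum_i `|u 0 (f i)|.
    rewrite -[u 0 j](subrK (\sum_i u 0 (f i) * N i j)).
    by rewrite (le_trans (ler_normD _ _)) // lerD.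
  move: de; rewrite !natrM => de; nra.
have : \sum_j `|u 0 j| < 1.
  rewrite -(@ltr_pM2l _ (2 * d%:R)) ?mulr_gt0 // mulr1 mulr_sumr.
  rewrite [ltRHS](_ : _ = \sum_(j < d) 2); last by rewrite sumr_const card_ord mulr_natr.
  apply: ltr_sum => [|j _]; last exact: uj.
  by apply/hasP; exists (Ordinal (leq_trans k1 (ltnW kd))) => //; rewrite mem_index_enum.
by rewrite ltNge -u1 enorm_le_sum_coord.
Qed.

(* Since [u] is almost [sum_l u_(f l) N_l] and [u_(f i)] is bounded below, the
   other rows of [N] determine row [i] up to [O(e)], and the columns in the image
   of [f] are fixed: only [(k - 1) (d - k)] entries need to be discretized. *)
Lemma chart_piece_cover (u : 'rV[R]_d) e f i : enorm u = 1 -> 0 < e -> e <= 1 ->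
  exists2 m : nat, m%:R <= (3 / e) ^+ ((k - 1) * (d - k)) &
  fin_cover (chart_piece u e f i) m
    (2 * (d%:R * (k%:R * ((2 * d * k)%:R * (3 * k.+1%:R * e))))).
Proof.
move=> u1 e0 e1.
(* An empty piece needs no sets. A member of a nonempty one shows that [f] is injective, hence that
   [d - k] columns are free. *)
have [[V0 [_ [N0 VN0] _]]|noV] := pselect (exists V, chart_piece u e f i V); last first.
  exists 0%N; first by rewrite exprn_ge0 // divr_ge0 // ltW.
  exists (fun=> set0); split=> // V Vp.
  by case: noV; exists V.
have f_inj := chart_inj VN0.
pose M := Num.truncn (2 / e).
pose D : {pred 'I_k * 'I_d} := [pred p | (p.1 != i) && (p.2 \notin codom f)].
have cD : #|D| = ((k - 1) * (d - k))%N.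
  rewrite (_ : #|D| = #|[predX predC1 i & [predC (mem (codom f))]]|); last first.
    by apply: eq_card.
  rewrite cardX cardC1 card_ord -subn1; congr (_ * _)%N.
  have := cardC (mem (codom f)); rewrite card_codom // card_ord => kE.
  by apply/eqP; rewrite -(eqn_add2l k) kE card_ord subnKC // ltnW.
have [N NP] : exists N : grassmannian R d k -> 'M[R]_(k, d),
    forall V, chart_piece u e f i V -> is_chart V f (N V).
  have /choice[N NP] : forall V, exists N, chart_piece u e f i V -> is_chart V f N.
    move=> V; have [[_ [N VN] _]|nV] := pselect (chart_piece u e f i V).
      by exists N.
    by exists 0.
  by exists N.
(* Shifted by 1, the entries lie in [0, 2], which meets [M + 1] cells of length [e];
   [M + 1 <= 3 / e] because [e <= 1]. *)
pose g V (p : 'I_k * 'I_d) : nat := Num.truncn ((N V p.1 p.2 + 1) / e).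
pose h V : {ffun 'I_k * 'I_d -> 'I_M.+1} :=
  [ffun p => if p \in D then inord (g V p) else ord0].
exists #|pffun_on ord0 D (predT : {pred 'I_M.+1})|.
  rewrite card_pffun_on cD cardT size_enum_ord natrX lerXn2r ?nnegrE //.
    by rewrite divr_ge0 // ltW.
  have Me : M%:R <= 2 / e by rewrite truncn_le // divr_ge0 // ltW.
  rewrite -natr1; apply: (le_trans (lerD Me (lexx 1))).
  by rewrite ler_pdivlMr // mulrDl divfK ?gt_eqF // mul1r; lra.
apply: (fin_cover_code (h := h)) => [V _|V W Vp Wp hVW].
  apply/pffun_onP; split=> //.
  by apply/supportP => p pD; rewrite ffunE (negbTE pD).
apply: (gr_dist_chart_le _ (NP V Vp) (NP W Wp)).
  by rewrite !mulr_ge0 // ltW.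
have VN := NP V Vp; have WN := NP W Wp.
have offdiag l j : l != i -> `|N V l j - N W l j| <= e.
  move=> li; have [/codomP[b ->]|jf] := boolP (j \in codom f).
    have [/matrixP/(_ l b) + _ _] := VN; have [/matrixP/(_ l b) + _ _] := WN.
    by rewrite !mxE => -> ->; rewrite subrr normr0 ltW.
  have lj : (l, j) \in D by rewrite inE /= li jf.
  have gM X : chart_piece u e f i X -> (g X (l, j) < M.+1)%N /\
      0 <= (N X l j + 1) / e.
    move=> Xp; have [_ N1 _] := NP X Xp; have := N1 l j; rewrite ler_norml => /andP[a b].
    split; last by rewrite divr_ge0 ?(ltW e0) //; lra.
    rewrite ltnS /g /M; apply: le_truncn; rewrite ler_pM2r ?invr_gt0 //=; lra.
  have [gV V0'] := gM V Vp; have [gW W0'] := gM W Wp.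
  have /(congr1 val) := congr1 (fun F : {ffun _ -> _} => F (l, j)) hVW.
  rewrite !ffunE lj /= !inordK // /g /= => tVW.
  have /andP[a1 a2] := truncn_itv V0'; have /andP[b1 b2] := truncn_itv W0'.
  rewrite tVW in a1 a2.
  have : `|(N V l j + 1) / e - (N W l j + 1) / e| <= 1.
    rewrite ler_norml -natr1 in a2 b2 *; apply/andP; split; lra.
  rewrite -mulrBl normrM [`|e^-1|]gtr0_norm ?invr_gt0 // ler_pdivrMr // mul1r.
  by rewrite opprD addrACA subrr addr0.
move=> l j; have [->|li] := eqVneq l i; last first.
  apply: le_trans (offdiag l j li) _.
  have : 1 <= (2 * d * k)%:R :> R by rewrite ler1n !muln_gt0 k1 (leq_trans _ kd).
  have : 1 <= k.+1%:R :> R by rewrite ler1n.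
  move: (k.+1%:R : R) ((2 * d * k)%:R : R) => x y x1 y1.
  have : 1 <= y * (3 * x) by nra.
  by rewrite mulrA; nra.
have [Vu _ ui] := Vp; have [Wu _ _] := Wp.
have h1 := chart_near j VN Vu; have h2 := chart_near j WN Wu.
have h3 : `|\sum_l u 0 (f l) * (N V l j - N W l j)| <= 2 * (k.+1%:R * e).
  have -> : \sum_l u 0 (f l) * (N V l j - N W l j) =
     (u 0 j - \sum_i u 0 (f i) * N W i j) - (u 0 j - \sum_i u 0 (f i) * N V i j).
    rewrite opprB addrC addrA subrK -sumrB; apply: eq_bigr => b _; ring.
  by rewrite (le_trans (ler_normB _ _)) // mulrDl mul1r lerD.
(* In the difference of the two chart equations each row [l != i] contributes at most [e], as [u]
   has norm 1; this isolates row [i]. *)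
have h4 : `|u 0 (f i)| * `|N V i j - N W i j| <= 3 * k.+1%:R * e.
  rewrite -normrM; move: h3; rewrite (bigD1 i) //= => h3.
  rewrite -[X in `|X|](addrK (\sum_(l < k | l != i) u 0 (f l) * (N V l j - N W l j))).
  rewrite (le_trans (ler_normB _ _)) //.
  have : `|\sum_(l < k | l != i) u 0 (f l) * (N V l j - N W l j)| <= k%:R * e.
    rewrite big_mkcond /= (le_trans (ler_norm_sum _ _ _)) // sum_ord_le // => b.
    case: ifP => [bi|_]; last by rewrite normr0 ltW.
    rewrite normrM -[e]mul1r ler_pM ?offdiag //.
    by rewrite -u1 coord_le_enorm.
  rewrite -natr1 in h3 *; lra.
apply: (@le_trans _ _ ((2 * d * k)%:R * (`|u 0 (f i)| * `|N V i j - N W i j|))).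
  by rewrite mulrA ler_peMl.
by rewrite ler_wpM2l.
Qed.

(** The number of pairs [(f, i)] depends only on [d] and [k], so [K] absorbs it. *)
Lemma near_direction_cover : exists (K e0 : R), [/\ 0 < K, 0 < e0 &
  forall (u : 'rV[R]_d) e, enorm u = 1 -> 0 < e -> e <= e0 ->
  exists2 m : nat, m%:R <= K * (e^-1) ^+ ((k - 1) * (d - k)) &
    fin_cover (near_direction u e) m (K * e)].
Proof.
pose q := ((k - 1) * (d - k))%N; pose X : finType := ({ffun 'I_k -> 'I_d} * 'I_k)%type.
pose C : R := 2 * (d%:R * (k%:R * ((2 * d * k)%:R * (3 * k.+1%:R)))).
have d0 : (0 < d)%N by rewrite (leq_trans _ kd).
have C0 : 0 < C by rewrite !mulr_gt0 ?ltr0n // !muln_gt0 d0 k1.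
have D0 : 0 < (2 * d * k.+1)%:R :> R by rewrite ltr0n !muln_gt0 d0.
exists (#|X|%:R * 3 ^+ q + C), ((2 * d * k.+1)%:R^-1); split.
- by rewrite ltr_wpDl // mulr_ge0 // exprn_ge0.
- by rewrite invr_gt0.
move=> u e u1 e0 ee0.
have de : (2 * d * k.+1)%:R * e <= 1.
  by rewrite mulrC -ler_pdivlMr // mul1r.
have e1 : e <= 1.
  apply: le_trans de; rewrite ler_peMl ?(ltW e0) // ler1n !muln_gt0 d0 //.
pose M := Num.truncn ((3 / e) ^+ q).
have b0 : 0 <= (3 / e) ^+ q by rewrite exprn_ge0 // divr_ge0 // ltW.
have e'0 : 0 <= e^-1 ^+ q by rewrite exprn_ge0 // invr_ge0 ltW.
exists (#|X| * M)%N.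
  rewrite natrM mulrDl (le_trans (y := #|X|%:R * 3 ^+ q * e^-1 ^+ q)) //.
    by rewrite -mulrA -exprMn ler_wpM2l // truncn_le.
  by rewrite lerDl mulr_ge0 // ltW.
apply: fin_cover_sub (near_direction_pieces u1 (ltW e0) de) _.
apply: (@fin_cover_union _ _ X) => -[f i] /=.
have [m mM mC] := chart_piece_cover f i u1 e0 e1.
apply: fin_cover_le mC.
  by rewrite truncn_ge_nat.
rewrite (_ : 2 * _ = C * e); last by rewrite /C; ring.
by rewrite ler_wpM2r ?(ltW e0) // lerDr mulr_ge0 // exprn_ge0.
Qed.

End NearDirection.

(** * Bounding Hausdorff dimension by sequences of finite covers *)

Section HausdorffCovers.
Context {R : realType} {T : metricType R}.
Local Open Scope ereal_scope.

Lemma hausdorff_premeasure_ge0 s delta (E : set T) :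
  0 <= hausdorff_premeasure s delta E.
Proof.
apply: le_ereal_inf_tmp => _ [U _ <-]; apply: nneseries_ge0 => n _ _.
by rewrite /diam_pow; case: ifP => // _; exact: poweR_ge0.
Qed.

Lemma diam_le (U : set T) (e : R) : (forall x y, U x -> U y -> (mdist x y <= e)%R) ->
  diam U <= e%:E.
Proof.
move=> Ue; apply: ge_ereal_sup => _ [[x y] [/= Ux Uy] <-].
by rewrite lee_fin Ue.
Qed.

Lemma diam_pow_le (s e : R) (U : set T) : (0 <= s)%R ->
  (forall x y, U x -> U y -> (mdist x y <= e)%R) ->
  diam_pow s U <= (e `^ s)%:E.
Proof.
move=> s0 Ue; rewrite /diam_pow; case: ifPn => [_|/set0P[x Ux]].
  by rewrite lee_fin powR_ge0.
have d0 : 0 <= diam U.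
  by apply: ereal_sup_ubound; exists (x, x) => //=; rewrite mdistxx.
have e0 : (0 <= e)%R by rewrite -lee_fin (le_trans d0) // diam_le.
rewrite -poweR_EFin gt0_ler_poweR ?diam_le // in_itv /= ?d0 ?leey //.
by rewrite lee_fin e0.
Qed.

Lemma hausdorff_dim_mono (E F : set T) : E `<=` F ->
  hausdorff_dim E <= hausdorff_dim F.
Proof.
move=> EF; apply: le_ereal_inf => _ [s [s0 sF] <-]; exists s => //; split=> //.
apply/le_anti/andP; split; last first.
  apply: le_trans (hausdorff_premeasure_ge0 s 1 E) _.
  by apply: ereal_sup_ubound; exists 1%R => //=.
rewrite -sF; apply: ge_ereal_sup => _ [delta delta0 <-].
apply: (@le_trans _ _ (hausdorff_premeasure s delta F)); last first.
  by apply: ereal_sup_ubound; exists delta.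
apply: le_ereal_inf => _ [U [FU Ud] <-]; exists U => //; split=> //.
exact: subset_trans FU.
Qed.

(** Each finite cover is padded with empty sets, which cost 0. A bijection of [nat] with [nat * nat]
    lists all pieces in one sequence, and nonnegativity allows summing row by row. *)
Lemma premeasure_le_series (s delta : R) (E : set T) (F : nat -> set T)
    (m : nat -> nat) (e : nat -> R) : (0 <= s)%R -> (0 < delta)%R ->
  E `<=` \bigcup_n F n -> (forall n, fin_cover (F n) (m n) (e n)) ->
  (forall n, (e n <= delta)%R) ->
  hausdorff_premeasure s delta E <= \sum_(0 <= n <oo) ((m n)%:R * e n `^ s)%:E.
Proof.
move=> s0 delta0 EF Fc ed.
have /choice[S SP] n : exists S : nat -> set T,
    [/\ F n `<=` \bigcup_i S i, forall i, (m n <= i)%N -> S i = set0 &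
        forall i x y, S i x -> S i y -> (mdist x y <= e n)%R].
  have [S [FS Se]] := Fc n.
  exists (fun i => if insub i is Some j then S j else set0); split.
  - by move=> x /FS[i _ Six]; exists (val i) => //=; rewrite valK.
  - by move=> i mi; rewrite insubF // ltnNge mi.
  - by move=> i x y; case: insubP => // j _ _; exact: Se.
pose U (p : nat * nat) : set T := S p.1 p.2.
have Ud p x y : U p x -> U p y -> (mdist x y <= e p.1)%R.
  by have [_ _] := SP p.1; apply.
have U0 p : 0 <= diam_pow s (U p).
  by rewrite /diam_pow; case: ifP => // _; exact: poweR_ge0.
have [h hbij] : exists h : nat -> nat * nat, set_bij [set: nat] [set: nat * nat] h.
  by apply/card_set_bijP; rewrite card_eq_sym; exact: card_nat2.
apply: (@le_trans _ _ (\sum_(0 <= n <oo) diam_pow s (U (h n)))).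
  apply: ereal_inf_lbound; exists (fun n => U (h n)) => //; split.
    move=> x /EF[n _ Fx]; have [FS _ _] := SP n; have [i _ Sx] := FS x Fx.
    have [_ _ hsurj] := hbij; have [j _ hj] := hsurj (n, i) I.
    by exists j => //; rewrite /U hj.
  by move=> n; apply: diam_le => x y Ux Uy; apply: le_trans (Ud _ _ _ Ux Uy) (ed _).
rewrite nneseries_esumT; last by move=> n; exact: U0.
rewrite -(reindex_esum [set: nat] [set: nat * nat] h (fun p => diam_pow s (U p))) //.
rewrite (_ : [set: nat * nat] = [set: nat] `*`` (fun=> [set: nat])); last first.
  by apply/seteqP; split.
rewrite -(esum_esum (a := fun i j => diam_pow s (U (i, j)))) //.
rewrite -nneseries_esumT; last by move=> n; apply: esum_ge0.
apply: lee_nneseries => [n _ _|n _]; first exact: esum_ge0.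
rewrite -nneseries_esumT //.
rewrite (nneseries_split 0 (m n)) ?add0n // [X in _ + X]eseries0 ?adde0; last first.
  by move=> i mi _; have [_ S0 _] := SP n; rewrite /U S0 // /diam_pow eqxx.
rewrite big_mkord; apply: (@le_trans _ _ (\sum_(i < m n) (e n `^ s)%:E)).
  by apply: lee_sum => i _; apply: diam_pow_le => // x y; exact: (Ud (n, val i)).
by rewrite sumEFin sumr_const card_ord mulr_natl.
Qed.

Lemma eseries_geometric_le (a : nat -> R) (b q : R) : (0 <= q)%R -> (q < 1)%R ->
  (forall n, (0 <= a n)%R) -> (forall n, (a n <= b * q ^+ n)%R) ->
  \sum_(0 <= n <oo) (a n)%:E <= (b / (1 - q))%:E.
Proof.
move=> q0 q1 a0 ab.
apply: (@le_trans _ _ (\sum_(0 <= n <oo) (geometric b q n)%:E)).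
  by apply: lee_nneseries => n *; rewrite lee_fin //; exact: ab.
have := @cvg_geometric_series R b q; rewrite ger0_norm // => /(_ q1) cv.
rewrite (_ : (fun n => _) = EFin \o series (geometric b q)); last first.
  by apply/funext => n /=; rewrite /series /= sumEFin.
rewrite EFin_lim //; last by apply/cvg_ex; exists (b / (1 - q))%R.
by rewrite (cvg_lim _ cv).
Qed.

(** The covers have mesh at most [delta] and total cost at most the geometric sum [b / (1 - q)],
    both arbitrarily small, so the [s]-dimensional measure vanishes. *)
Lemma hausdorff_dim_le (E : set T) (s : R) : (0 <= s)%R ->
  (forall delta : R, (0 < delta)%R ->
     exists (F : nat -> set T) (m : nat -> nat) (e : nat -> R) (b q : R),
     [/\ [/\ (0 <= q)%R, (q < 1)%R & (b / (1 - q) <= delta)%R],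
        E `<=` \bigcup_n F n, forall n, fin_cover (F n) (m n) (e n),
        forall n, (e n <= delta)%R &
        forall n, ((m n)%:R * e n `^ s <= b * q ^+ n)%R]) ->
  hausdorff_dim E <= s%:E.
Proof.
move=> s0 H; apply: ereal_inf_lbound; exists s => //; split=> //.
apply/le_anti/andP; split; last first.
  apply: le_trans (hausdorff_premeasure_ge0 s 1 E) _.
  by apply: ereal_sup_ubound; exists 1%R => //=.
apply: ge_ereal_sup => _ [delta /= delta0 <-].
apply/lee_addgt0Pr => x x0; rewrite add0e.
have dx : (0 < Num.min delta x)%R by rewrite lt_min delta0.
have [F [m [e [b [q [[q0 q1 bq] EF Fc ed me]]]]]] := H _ dx.
apply: (@le_trans _ _ (b / (1 - q))%:E).
  apply: le_trans (premeasure_le_series s0 delta0 EF Fc _) _.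
    by move=> n; rewrite (le_trans (ed n)) // ge_min lexx.
  by apply: eseries_geometric_le => // n; rewrite mulr_ge0 ?powR_ge0.
by rewrite lee_fin (le_trans bq) // ge_min lexx orbT.
Qed.

End HausdorffCovers.

(** * Covers obtained from the upper box dimension *)

Section BoxCovers.
Context {R : realType} {d : nat}.
Implicit Type A : set 'rV[R]_d.

Lemma covering_number_ge1 A e : (1 <= covering_number A e)%E.
Proof.
apply: le_ereal_inf_tmp => _ [n [n0 _] <-].
by rewrite lee_fin ler1n.
Qed.

(** An upper limit below [t] bounds the logarithm of the covering number by [t * - ln e] at all
    small scales; [e < 1] keeps [- ln e] positive. *)
Lemma box_dim_cover A (t : R) : (upper_box_dim A < t%:E)%E ->
  exists2 e0 : R, 0 < e0 & forall e, 0 < e -> e < e0 ->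
  exists (n : nat) (c : 'I_n -> 'rV[R]_d), n%:R <= e `^ (- t) /\
    forall x, A x -> exists i, enorm (x - c i) <= e.
Proof.
rewrite /upper_box_dim limf_esupE => /ereal_inf_lt[_ [V V0 <-] Vt].
have [e1 /= e10 Ve1] := V0.
exists (Num.min e1 1) => [|e e0]; first by rewrite lt_min e10 ltr01.
rewrite lt_min => /andP[ee1 ee2].
have L0 : 0 < - ln e by rewrite oppr_gt0 ln_lt0 // e0.
have Ve : V e by apply: Ve1 => //=; rewrite sub0r normrN gtr0_norm.
have lt1 : (lne (covering_number A e) * ((- ln e)^-1)%:E < t%:E)%E.
  by apply: le_lt_trans Vt; apply: ereal_sup_ubound; exists e.
have lt2 : (covering_number A e < (e `^ (- t))%:E)%E.
  have et0 : 0 < e `^ (- t) by rewrite powR_gt0.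
  have lnet : lne (e `^ (- t))%:E = (t * - ln e)%:E.
    by rewrite lne_EFin // ln_powR mulNr mulrN.
  rewrite -lte_lne; [|rewrite in_itv /= leey andbT|rewrite in_itv /= leey andbT].
  - by rewrite lnet EFinM -lte_pdivrMr.
  - by rewrite (le_trans _ (covering_number_ge1 A e)).
  - by rewrite lee_fin ltW.
have /ereal_inf_lt[_ [n [_ [c cP]] <-] nt] := lt2.
by exists n, c; split => //; rewrite -lee_fin ltW.
Qed.

Lemma upper_box_dim_ge0 A : (0 <= upper_box_dim A)%E.
Proof.
rewrite /upper_box_dim limf_esupE; apply: le_ereal_inf_tmp => _ [V V0 <-].
have [e1 /= e10 Ve1] := V0.
pose e := Num.min (e1 / 2) (1 / 2).
have e0 : 0 < e by rewrite lt_min !divr_gt0.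
have ee1 : e < e1 by rewrite gt_min; apply/orP; left; lra.
have e1' : e < 1 by rewrite gt_min; apply/orP; right; lra.
have Ve : V e by apply: Ve1 => //=; rewrite sub0r normrN gtr0_norm.
apply: (@le_trans _ _ (lne (covering_number A e) * ((- ln e)^-1)%:E)%E).
  rewrite mule_ge0 ?lne_ge0 ?covering_number_ge1 // lee_fin invr_ge0 ltW //.
  by rewrite oppr_gt0 ln_lt0 // e0.
by apply: ereal_sup_ubound; exists e.
Qed.

End BoxCovers.

(** * Planes along which some pair of points at a given scale nearly collapses *)

Section ExceptionalPlanes.
Context {R : realType} {d k : nat}.
Implicit Types (A : set 'rV[R]_d) (V : {vspace 'rV[R]_d}) (x y a b : 'rV[R]_d).

Definition short_projection A (e r : R) : set (grassmannian R d k) :=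
  [set V | exists x y, [/\ A x, A y, enorm (perp_proj (plane V) (x - y)) <= e,
     r / 2 <= enorm (x - y) & 0 < r]].

(** Moving [x] and [y] to the centers changes their difference by at most [2 e]. So [a - b] has
    projection at most [3 e] and length at least [r / 2 - 2 e >= r / 4], whence the factor 12. *)
Lemma direction_of_centers V x y a b (e r : R) :
  enorm (x - a) <= e -> enorm (y - b) <= e ->
  enorm (perp_proj V (x - y)) <= e -> r / 2 <= enorm (x - y) ->
  8 * e <= r -> 0 < r ->
  0 < enorm (a - b) /\
  enorm (perp_proj V ((enorm (a - b))^-1 *: (a - b))) <= 12 * (e / r).
Proof.
move=> xa yb Pe rxy er r0.
have e0 : 0 <= e by rewrite (le_trans _ xa) // enorm_ge0.
have abE : a - b = (x - y) - ((x - a) - (y - b)).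
  by rewrite !opprB !addrA; apply/rowP => i; rewrite !mxE; ring.
have xyE : x - y = (a - b) + ((x - a) - (y - b)).
  by apply/rowP => i; rewrite !mxE; ring.
have z2 : enorm ((x - a) - (y - b)) <= 2 * e.
  by rewrite (le_trans (enormD _ _)) // enormN; lra.
have ab : r / 4 <= enorm (a - b).
  by have := enormD (a - b) ((x - a) - (y - b)); rewrite -xyE; lra.
have ab0 : 0 < enorm (a - b) by lra.
split=> //; rewrite linearZ /= enormZ gtr0_norm ?invr_gt0 //.
have Pab : enorm (perp_proj V (a - b)) <= 3 * e.
  rewrite abE perp_proj_sub (le_trans (enormD _ _)) // enormN.
  by have := enorm_perp_proj V ((x - a) - (y - b)); lra.
rewrite mulrC ler_pdivrMr // (le_trans Pab) //.
have -> : 3 * e = 12 * (e / r) * (r / 4) by field; rewrite gt_eqF.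
by rewrite ler_wpM2l // mulr_ge0 // divr_ge0 // ltW.
Qed.

(** The [n ^ 2] pairs of centers supply the directions; pairs of coinciding centers get empty
    sets. *)
Lemma short_projection_cover A (e r K B : R) n (c : 'I_n -> 'rV[R]_d) :
  (forall x, A x -> exists i, enorm (x - c i) <= e) -> 8 * e <= r ->
  0 <= B ->
  (forall u : 'rV[R]_d, enorm u = 1 -> exists2 m : nat, m%:R <= B &
    fin_cover (near_direction u (12 * (e / r)) : set (grassmannian R d k)) m K) ->
  exists2 m : nat, m%:R <= n%:R ^+ 2 * B & fin_cover (short_projection A e r) m K.
Proof.
move=> Ac er B0 H.
pose X : finType := ('I_n * 'I_n)%type.
pose P (p : X) : set (grassmannian R d k) :=
  [set V | 0 < enorm (c p.1 - c p.2) /\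
     near_direction ((enorm (c p.1 - c p.2))^-1 *: (c p.1 - c p.2)) (12 * (e / r)) V].
exists (#|X| * Num.truncn B)%N.
  by rewrite card_prod card_ord natrM natrM -expr2 ler_wpM2l ?exprn_ge0 // truncn_le.
apply: (@fin_cover_sub _ _ _ (\bigcup_p P p)).
  move=> V [x [y [/Ac[i xi] /Ac[j yj] Pe rxy r0]]]; exists (i, j) => //=.
  exact: direction_of_centers xi yj Pe rxy er r0.
apply: fin_cover_union => -[i j].
have [ij0|ij0] := ltP 0 (enorm (c i - c j)); last first.
  by exists (fun=> set0); split => // V [/=]; rewrite ltNge ij0.
have [|m mB mC] := H ((enorm (c i - c j))^-1 *: (c i - c j)).
  by rewrite enormZ gtr0_norm ?invr_gt0 // mulVf // gt_eqF.
apply: (fin_cover_sub _ (fin_cover_le _ (lexx K) mC)); first by move=> V [].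
by rewrite truncn_ge_nat.
Qed.

(** [n] precedes the first index [m] with [D * 2^-1 ^+ m < r], which is not 0 as [r <= D]. *)
Lemma dyadic_scale (D r : R) : 0 < r -> r <= D ->
  exists n : nat, D * 2^-1 ^+ n / 2 <= r /\ r <= D * 2^-1 ^+ n.
Proof.
move=> r0 rD; have D0 : 0 < D by exact: lt_le_trans rD.
have ex : exists m, D * 2^-1 ^+ m < r.
  exists (Num.truncn (D / r)).+1; rewrite exprVn ltr_pdivrMr ?exprn_gt0 //.
  rewrite mulrC -ltr_pdivrMr // (lt_trans (truncnS_gt _)) //.
  by rewrite -natrX ltr_nat ltn_expl.
case: (ex_minnP ex) => -[|n] nr nmin.
  by move: nr; rewrite expr0 mulr1 ltNge rD.
exists n; split; first by move: nr; rewrite exprSr mulrA => /ltW.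
by rewrite leNgt; apply/negP => /nmin; rewrite ltnn.
Qed.

Lemma small_scale (X Y Z a : R) : 0 <= X -> 0 < Y -> 0 <= Z -> 0 < a ->
  exists c : R, [/\ 0 < c, c * X <= Y & Z * c `^ a <= Y].
Proof.
move=> X0 Y0 Z0 a0.
pose c1 := Y / (X + 1); pose c2 := (Y / (Z + 1)) `^ a^-1.
have X1 : 0 < X + 1 by rewrite ltr_wpDl.
have Z1 : 0 < Z + 1 by rewrite ltr_wpDl.
have c10 : 0 < c1 by rewrite divr_gt0.
have c20 : 0 < c2 by rewrite powR_gt0 // divr_gt0.
exists (Num.min c1 c2); split; first by rewrite lt_min c10.
  apply: (@le_trans _ _ (c1 * X)); first by rewrite ler_wpM2r // ge_min lexx.
  by rewrite [c1 * X]mulrAC ler_pdivrMr // mulrDr mulr1 lerDl ltW.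
apply: (@le_trans _ _ (Z * c2 `^ a)).
  rewrite ler_wpM2l // ge0_ler_powR ?nnegrE ?(ltW a0) ?(ltW c20) //.
    by rewrite le_min !ltW.
  by rewrite ge_min lexx orbT.
rewrite /c2 -powRrM mulVf ?gt_eqF // powRr1; last by rewrite divr_ge0 // ltW.
by rewrite mulrA [Z * Y]mulrC ler_pdivrMr // mulrDr mulr1 lerDl ltW.
Qed.

End ExceptionalPlanes.

(** * Summation over the scales *)

Section Dimension.
Context {R : realType} {d k : nat} (k1 : (1 <= k)%N) (kd : (k < d)%N).

(** At scale [r], with [ep = c r^be] and [de = ep / r], there are about [ep^(-2t') de^(-p)] sets of
    diameter about [de]. Their [w]-dimensional sum is of order [ep^(-2t') de^s = c^(s - 2t') r^ga],
    with both exponents positive. *)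
Lemma exceptional_hausdorff_dim (A : set 'rV[R]_d) (t w : R) : ebounded A ->
  (upper_box_dim A < t%:E)%E ->
  (k%:R - 1) * (d%:R - k%:R) + 2 * t < w ->
  (hausdorff_dim [set V : grassmannian R d k |
     ~ in_hoelder_graph A
         (1 - 2 * t / (w - (k%:R - 1) * (d%:R - k%:R))) (plane V)] <= w%:E)%E.
Proof.
move=> [M AM] At.
pose p := ((k - 1) * (d - k))%N.
have pE : (k%:R - 1) * (d%:R - k%:R) = p%:R :> R.
  by rewrite /p natrM !natrB // ltnW.
rewrite pE => ptw.
have t0 : 0 < t by rewrite -lte_fin (le_lt_trans (upper_box_dim_ge0 A)).
have [t' [At' t'0 t't]] : exists t', [/\ (upper_box_dim A < t'%:E)%E, 0 < t' & t' < t].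
  have B0 := upper_box_dim_ge0 A.
  move: At B0; case: (upper_box_dim A) => // b; rewrite lte_fin lee_fin => bt b0.
  by exists ((b + t) / 2); rewrite lte_fin; split; lra.
set s := w - p%:R.
have st : 2 * t < s by rewrite /s; lra.
have s0 : 0 < s by lra.
have w0 : 0 <= w by rewrite (le_trans _ (ltW ptw)) // addr_ge0 // mulr_ge0 // ltW.
set th := 1 - 2 * t / s.
have th0 : 0 < th by rewrite subr_gt0 ltr_pdivrMr // mul1r.
have th1 : th <= 1 by rewrite gerBl divr_ge0 // ?mulr_ge0 // ltW.
pose be := th^-1; pose b1 := be - 1.
have thE : th = (s - 2 * t) / s by rewrite /th; field; rewrite gt_eqF.
have b10 : 0 < b1 by rewrite subr_gt0 invf_gt1 // /th gtrBl divr_gt0 // mulr_gt0.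
(* With [t] in place of [t'], [ga] would vanish: the exponent [th] is borderline,
   and the slack [t - t'] makes the sum over scales converge. *)
pose ga := b1 * s - 2 * t' * be.
have ga0 : 0 < ga.
  have -> : ga = 2 * (t - t') * s / (s - 2 * t).
    rewrite /ga /b1 /be thE; field.
    by rewrite (gt_eqF s0) gt_eqF ?subr_gt0.
  have tt : 0 < t - t' by lra.
  have stt : 0 < s - 2 * t by lra.
  by rewrite divr_gt0 // !mulr_gt0.
have [e1 e10 boxA] := box_dim_cover At'.
have [K [e0 [K0 e00 nearK]]] := @near_direction_cover R d k k1 kd.
pose D := 2 * `|M| + 1.
have D0 : 0 < D by rewrite ltr_wpDl // mulr_ge0.
have AD x y : A x -> A y -> enorm (x - y) <= D.
  move=> /AM xM /AM yM; rewrite (le_trans (enormD _ _)) // enormN /D.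
  by have := ler_norm M; lra.
apply: hausdorff_dim_le => // delta delta0.
pose q := 2^-1 `^ ga.
have q0 : 0 <= q by rewrite powR_ge0.
have q1 : q < 1.
  have <- : 1 `^ ga = 1 by rewrite powR1.
  by rewrite gt0_ltr_powR ?nnegrE ?invr_ge0 // invf_lt1 // ltr1n.
pose C0 := K `^ (1 + w) * 12 `^ s * D `^ ga.
have C00 : 0 <= C0 by rewrite !mulr_ge0 ?powR_ge0.
(* [c * X] bounds [ep n] and [12 * (1 + K) * de n] at every scale. [Y] collects the thresholds: the
   box scale (halved for a strict inequality), the chart scale, 1 and the mesh [delta]. *)
pose X := D `^ be + 12 * (1 + K) * D `^ b1.
pose Y := Num.min (Num.min (e1 / 2) e0) (Num.min 1 delta).
have X0 : 0 <= X by rewrite addr_ge0 ?powR_ge0 // !mulr_ge0 ?powR_ge0 // ?addr_ge0 // ltW.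
have Y0 : 0 < Y by rewrite /Y !lt_min e00 ltr01 delta0 !andbT divr_gt0.
have a0 : 0 < s - 2 * t' by lra.
have Z0 : 0 <= C0 / (1 - q) by rewrite divr_ge0 // subr_ge0 ltW.
have [c [c0 cX cZ]] := small_scale X0 Y0 Z0 a0.
pose r n := D * 2^-1 ^+ n.
have r0 n : 0 < r n by rewrite mulr_gt0 // exprn_gt0.
have rD n : r n <= D.
  by rewrite ler_piMr ?(ltW D0) // exprn_ile1 ?invr_ge0 // invf_le1 // ler1n.
pose ep n := c * r n `^ be.
pose de n := c * r n `^ b1.
have ep0 n : 0 < ep n by rewrite mulr_gt0 // powR_gt0.
have de0 n : 0 < de n by rewrite mulr_gt0 // powR_gt0.
have epde n : ep n = de n * r n.
  rewrite /ep /de -mulrA; congr (_ * _).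
  by rewrite mulrC mulr_powRB1 // ?ltW // invr_gt0.
have be0 : 0 <= be by rewrite invr_ge0 ltW.
have epY n : ep n <= Y.
  apply: le_trans cX; rewrite ler_pM2l //.
  apply: (@le_trans _ _ (D `^ be)).
    by rewrite ge0_ler_powR // nnegrE ltW.
  by rewrite lerDl !mulr_ge0 ?powR_ge0 // ?addr_ge0 // ltW.
have deY n : 12 * (1 + K) * de n <= Y.
  apply: le_trans cX; rewrite mulrCA ler_pM2l //.
  apply: (@le_trans _ _ (12 * (1 + K) * D `^ b1)).
    rewrite ler_pM2l ?mulr_gt0 ?addr_gt0 //.
    by rewrite ge0_ler_powR ?nnegrE ?(ltW b10) ?(ltW D0) ?(ltW (r0 n)).
  by rewrite lerDr powR_ge0.
have [Ye1 Ye0 Y1 Yd] : [/\ Y <= e1 / 2, Y <= e0, Y <= 1 & Y <= delta].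
  by rewrite /Y !ge_min !lexx !orbT; split.
have Kde n : 0 < K * de n by rewrite mulr_gt0.
pose B n := K * ((12 * (ep n / r n))^-1) ^+ p.
have epr n : ep n / r n = de n by rewrite epde mulfK // gt_eqF.
have level n : exists m : nat, m%:R <= (ep n `^ (- t')) ^+ 2 * B n /\
    fin_cover (short_projection A (ep n) (r n) : set (grassmannian R d k)) m (K * (12 * de n)).
  have [|N [ctr [Nep ctrA]]] := boxA (ep n) (ep0 n).
    by have := epY n; lra.
  have B0 : 0 <= B n.
    by rewrite mulr_ge0 ?(ltW K0) // exprn_ge0 // invr_ge0 epr mulr_ge0 // ltW.
  have er : 8 * ep n <= r n.
    rewrite epde mulrA ler_piMl ?(ltW (r0 n)) //.
    have := deY n; have := Kde n; have := de0 n; lra.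
  have nK : forall u : 'rV[R]_d, enorm u = 1 -> exists2 m : nat, m%:R <= B n &
    fin_cover (near_direction u (12 * (ep n / r n)) : set (grassmannian R d k))
      m (K * (12 * de n)).
    move=> u u1; rewrite -epr; apply: nearK => //.
      by rewrite epr mulr_gt0.
    rewrite epr; have := deY n; have := Kde n; lra.
  have [m mB mC] := short_projection_cover ctrA er B0 nK.
  exists m; split=> //; apply: le_trans mB _; rewrite ler_wpM2r //.
  by rewrite lerXn2r ?nnegrE ?powR_ge0.
have [m mP] := choice level.
exists (fun n => short_projection A (ep n) (r n)), m, (fun n => K * (12 * de n)).
exists (C0 * c `^ (s - 2 * t')), q; split.
- split=> //; rewrite mulrAC; exact: le_trans cZ Yd.
- move=> V nV.
  (* Otherwise [|P_V (x - y)| >= c |x - y|^be] on [A], and raising to the power [th] gives the graph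
     criterion with constant [c^(-th)]. *)
  have [x [y [Ax Ay Pxy]]] : exists x y, [/\ A x, A y &
      enorm (perp_proj (plane V) (x - y)) < c * enorm (x - y) `^ be].
    apply: contrapT => H; apply: nV.
    apply: (@in_hoelder_graph_of_lower_bound _ _ _ _ ((c^-1) `^ th)) => //.
      exact: powR_ge0.
    move=> x y Ax Ay; rewrite -powRM ?invr_ge0 ?enorm_ge0 ?(ltW c0) //.
    have := enorm_ge0 (x - y); set z := enorm (x - y) => z0.
    have -> : z = (z `^ be) `^ th by rewrite -powRrM mulVf ?gt_eqF // powRr1.
    rewrite ge0_ler_powR ?nnegrE ?powR_ge0 ?(ltW th0) //.
      by rewrite mulr_ge0 ?enorm_ge0 // invr_ge0 ltW.
    rewrite mulrC ler_pdivlMr // mulrC leNgt; apply/negP => Pz.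
    by apply: H; exists x, y.
  have rxy : 0 < enorm (x - y).
    rewrite lt_def enorm_ge0 andbT; apply/eqP => z0.
    move: Pxy; rewrite z0 powR0 ?gt_eqF ?invr_gt0 // mulr0 ltNge enorm_ge0 //.
  have [n [rn1 rn2]] := dyadic_scale rxy (AD x y Ax Ay).
  exists n => //; exists x, y; split=> //.
  apply: le_trans (ltW Pxy) _; rewrite ler_pM2l //.
  by rewrite ge0_ler_powR // nnegrE ?enorm_ge0 // ltW.
- by move=> n; exact: (mP n).2.
- move=> n; have := deY n; have := Kde n; have := de0 n; lra.
move=> n.
apply: (@le_trans _ _ ((ep n `^ (- t')) ^+ 2 * B n * (K * (12 * de n)) `^ w)).
  by rewrite ler_wpM2r ?powR_ge0 // (mP n).1.
have de12 : 0 < 12 * de n by rewrite mulr_gt0.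
rewrite /B epr exprVn -!powR_mulrn ?powR_ge0 ?(ltW de12) // -!powRN.
rewrite (powRM _ (ltW K0) (ltW de12)).
have -> : (ep n `^ - t') `^ 2 * (K * (12 * de n) `^ (- p%:R)) *
    (K `^ w * (12 * de n) `^ w) =
    (K * K `^ w) * ((ep n `^ - t') `^ 2 * ((12 * de n) `^ w * (12 * de n) `^ (- p%:R))).
  ring.
rewrite -powRD; last by rewrite (gt_eqF de12) implybT.
rewrite -/s.
have -> : K * K `^ w = K `^ (1 + w).
  by rewrite powRD ?(gt_eqF K0) ?implybT // powRr1 // ltW.
rewrite -powRrM (powRM _ _ (ltW (de0 n))) // /ep /de.
have rb u : 0 <= r n `^ u by exact: powR_ge0.
rewrite !(powRM _ (ltW c0)) // -!powRrM.
have -> : K `^ (1 + w) * (c `^ (- t' * 2) * r n `^ (be * (- t' * 2)) *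
    (12 `^ s * (c `^ s * r n `^ (b1 * s)))) =
  K `^ (1 + w) * 12 `^ s * ((c `^ s * c `^ (- t' * 2)) *
   (r n `^ (b1 * s) * r n `^ (be * (- t' * 2)))).
  ring.
rewrite -!powRD ?(gt_eqF c0) ?(gt_eqF (r0 n)) ?implybT //.
have -> : s + - t' * 2 = s - 2 * t' by ring.
have -> : b1 * s + be * (- t' * 2) = ga by rewrite /ga; ring.
(* The dyadic scales turn the power [ga] into a geometric progression of ratio [q], the [ga]-th
   power of 1/2. *)
have -> : r n `^ ga = D `^ ga * q ^+ n.
  rewrite /r powRM ?(ltW D0) ?exprn_ge0 // /q; congr (_ * _).
  by rewrite -!powR_mulrn ?powR_ge0 ?invr_ge0 // powRAC.
have -> : 2^-1 `^ (ga * n%:R) = q ^+ n by rewrite powRrM powR_mulrn.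
by rewrite /C0 le_eqVlt; apply/orP; left; apply/eqP; ring.
Qed.

End Dimension.

(** * The dimension bound at a fixed exponent, and its limit for arbitrary exponents *)

Theorem theorem2p1 (R : realType) (d k : nat) (hk : (1 <= k)%N) (hkd : (k < d)%N)
    (A : set 'rV[R]_d) (hA : ebounded A) :
  (forall t w : R,
     (upper_box_dim A < t%:E)%E -> t < (d%:R - k%:R) / 2 ->
     (k%:R - 1) * (d%:R - k%:R) + 2 * t < w -> w < k%:R * (d%:R - k%:R) ->
     (hausdorff_dim [set V : grassmannian R d k |
        ~ in_hoelder_graph A
            (1 - 2 * t / (w - (k%:R - 1) * (d%:R - k%:R))) (plane V)]
      <= w%:E)%E)
  /\
  ((upper_box_dim A < ((d%:R - k%:R) / 2)%:E)%E ->
     (hausdorff_dim [set V : grassmannian R d k |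
        ~ exists a : R, in_hoelder_graph A a (plane V)]
      <= ((k%:R - 1) * (d%:R - k%:R))%:E + 2%:E * upper_box_dim A)%E).
Proof.
split=> [t w At _ tw _|]; first exact: exceptional_hausdorff_dim.
have := upper_box_dim_ge0 A.
case AE : (upper_box_dim A) => [b| |] // b0 _.
rewrite -EFinM -EFinD; apply/lee_addgt0Pr => e e0; rewrite -EFinD.
(* With [t = b + e / 4], twice [t] exceeds [2 * b] by [e / 2] only, which leaves room below the
   slack [e] in [w]. A plane that fails for every exponent fails for the one obtained here. *)
apply: le_trans (@exceptional_hausdorff_dim R d k hk hkd A (b + e / 4) _ hA _ _).
- apply: hausdorff_dim_mono => V /= nV inV; apply: nV.
  by eexists; exact: inV.
- by rewrite AE lte_fin; lra.
- lra.
Qed.
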